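(* Let $\mathbb{k}$ be a field, let $\mathcal{A}$ be a simplicial $\mathbb{k}$-algebra, let $\mathcal{B}$ and $\mathcal{C}$ be simplicial left modules over $\mathcal{A}$, and let $\mathcal{M}$ be a simplicial right module over $\mathcal{A}$. If there exists a presimplicial homotopy equivalence $f:\mathcal{B}\longrightarrow\mathcal{C}$, then $$\mathrm{H}_\bullet(\mathcal{M}\otimes_{\mathcal{A}}\mathcal{B})\cong \mathrm{H}_\bullet(\mathcal{M}\otimes_{\mathcal{A}}\mathcal{C}),$$ that is, $\mathrm{H}_n(\mathcal{M}\otimes_{\mathcal{A}}\mathcal{B})\cong \mathrm{H}_n(\mathcal{M}\otimes_{\mathcal{A}}\mathcal{C})$ as $\mathbb{k}$-vector spaces for every $n\geq 0$.
   Context: Throughout, $\mathbb{k}$ is a field and all $\mathbb{k}$-algebras are associative with multiplicative unit (not necessarily commutative). Simplicial $\mathbb{k}$-algebra: a collection of $\mathbb{k}$-algebras $\mathcal{A}=\{\mathcal{A}_n\}_{n\ge 0}$ with $\mathbb{k}$-algebra morphisms $\delta_i^{\mathcal{A}}:\mathcal{A}_n\to\mathcal{A}_{n-1}$ ($n\ge 1$) and $\sigma_i^{\mathcal{A}}:\mathcal{A}_n\to\mathcal{A}_{n+1}$ ($n\ge 0$), $0\le i\le n$, satisfying the simplicial identities: $\delta_i\delta_j=\delta_{j-1}\delta_i$ if $i<j$; $\sigma_i\sigma_j=\sigma_{j+1}\sigma_i$ if $i\le j$; $\delta_i\sigma_j=\sigma_{j-1}\delta_i$ if $i<j$; $\delta_i\sigma_j=\mathrm{id}$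 if $i=j$ or $i=j+1$; $\delta_i\sigma_j=\sigma_j\delta_{i-1}$ if $i>j+1$. Simplicial left module over $\mathcal{A}$: a simplicial $\mathbb{k}$-vector space $\mathcal{B}=\{\mathcal{B}_n\}_{n\ge0}$ (with $\mathbb{k}$-linear maps $\delta_i^{\mathcal{B}},\sigma_i^{\mathcal{B}}$ satisfying the same simplicial identities) together with a left $\mathcal{A}_n$-module structure on each $\mathcal{B}_n$ such that $\delta_i^{\mathcal{B}}(ab)=\delta_i^{\mathcal{A}}(a)\delta_i^{\mathcal{B}}(b)$ and $\sigma_i^{\mathcal{B}}(ab)=\sigma_i^{\mathcal{A}}(a)\sigma_i^{\mathcal{B}}(b)$ for all $a\in\mathcal{A}_n$, $b\in\mathcal{B}_n$, $0\le i\le n$. A simplicial right module is defined analogously, with right $\mathcal{A}_n$-module structures. Presimplicial morphism $f:\mathcal{B}\to\mathcal{C}$ of simplicial left modules over $\mathcal{A}$: a family of $\mathcal{A}_n$-module morphisms $f_n:\mathcal{B}_n\to\mathcal{C}_n$ ($n\ge0$) such that $f_{n-1}\delta_i^{\mathcal{B}}=\delta_i^{\mathcal{C}}f_n$ for all $n\ge1$ and $0\le i\le n$ (no compatibility with degeneracies is required). Identities $\mathrm{id}_{\mathcal{B}}$ and composites are taken degreewise. Presimplicial homotopy between presimplicial morphisms $f,g:\mathcal{B}\to\mathcal{C}$: a family of $\mathbb{k}$-linear maps $h_i:\mathcal{B}_n\to\mathcal{C}_{n+1}$, for $n\ge0$ and $0\le i\le n$, such that (i) $h_i(ab)=\sigma_i^{\mathcal{A}}(a)h_i(b)$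 for all $a\in\mathcal{A}_n$, $b\in\mathcal{B}_n$; and (ii) on $\mathcal{B}_n$: $\delta_i^{\mathcal{C}}h_j=h_{j-1}\delta_i^{\mathcal{B}}$ for $i<j$; $\delta_i^{\mathcal{C}}h_i=\delta_i^{\mathcal{C}}h_{i-1}$ for $0<i\le n$; $\delta_i^{\mathcal{C}}h_j=h_j\delta_{i-1}^{\mathcal{B}}$ for $i>j+1$; $\delta_0^{\mathcal{C}}h_0=f_n$; $\delta_{n+1}^{\mathcal{C}}h_n=g_n$. Presimplicial homotopy equivalence: a presimplicial morphism $f:\mathcal{B}\to\mathcal{C}$ for which there exists a presimplicial morphism $g:\mathcal{C}\to\mathcal{B}$ such that there is a presimplicial homotopy between $gf$ and $\mathrm{id}_{\mathcal{B}}$ and a presimplicial homotopy between $fg$ and $\mathrm{id}_{\mathcal{C}}$. The simplicial $\mathbb{k}$-module $\mathcal{M}\otimes_{\mathcal{A}}\mathcal{B}$: in degree $n$ it is $\mathcal{M}_n\otimes_{\mathcal{A}_n}\mathcal{B}_n$, with face maps $D_i(m\otimes_{\mathcal{A}_n} b)=\delta_i^{\mathcal{M}}(m)\otimes_{\mathcal{A}_{n-1}}\delta_i^{\mathcal{B}}(b)$ and degeneracy maps $S_i(m\otimes_{\mathcal{A}_n} b)=\sigma_i^{\mathcal{M}}(m)\otimes_{\mathcal{A}_{n+1}}\sigma_i^{\mathcal{B}}(b)$, $0\le i\le n$ (these are known to be well defined and to satisfy the simplicial identities). $\mathrm{H}_\bullet(\mathcal{M}\otimes_{\mathcal{A}}\mathcal{B})$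 denotes the homology of the associated chain complex with differential $\sum_{i=0}^n(-1)^iD_i$ from degree $n$ to degree $n-1$. *)

(* Defs.v *)
From HB Require Import structures.
From mathcomp Require Import all_boot all_algebra.
From mathcomp Require Import finmap boolp.
From mathcomp.multinomials Require Import monalg.

Set Implicit Arguments.
Unset Strict Implicit.
Unset Printing Implicit Defensive.

Import GRing.Theory.

Local Open Scope ring_scope.
Local Open Scope quotient_scope.

(** MathComp's [algType] is built on [nzRingType] and so excludes the zero
    algebra; here an algebra is a possibly zero ring together with a ring
    morphism from the field to its center.  *)

Record algebra_over (k : fieldType) := AlgebraOver {
  alg_ring :> pzRingType;
  alg_scalar : {rmorphism k -> alg_ring};
  alg_scalar_central : forall c a, alg_scalar c * a = a * alg_scalar c
}.

Arguments alg_scalar {k} A : rename.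

(** Face and degeneracy operators are indexed by ordinals: those starting or
    ending in degree [n] as [face n i : X n.+1 -> X n] with [i : 'I_n.+2], and
    [degen n i : X n -> X n.+1] with [i : 'I_n.+1].  In the identities below
    the indices range over [nat] within explicit bounds that make every
    [inord] the ordinal of the same value.  *)

Record simplicial_identities (X : nat -> Type)
    (d : forall n, 'I_n.+2 -> X n.+1 -> X n)
    (s : forall n, 'I_n.+1 -> X n -> X n.+1) : Prop := SimplicialIdentities {
  simp_dd : forall n (i j : nat) (x : X n.+2), (i < j <= n.+2)%N ->
    d n (inord i) (d n.+1 (inord j) x) = d n (inord j.-1) (d n.+1 (inord i) x);
  simp_ss : forall n (i j : nat) (x : X n), (i <= j <= n)%N ->
    s n.+1 (inord i) (s n (inord j) x) = s n.+1 (inord j.+1) (s n (inord i) x);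
  simp_ds_lt : forall n (i j : nat) (x : X n.+1), (i < j <= n.+1)%N ->
    d n.+1 (inord i) (s n.+1 (inord j) x) = s n (inord j.-1) (d n (inord i) x);
  simp_ds_id : forall n (j : nat) (x : X n), (j <= n)%N ->
    d n (inord j) (s n (inord j) x) = x;
  simp_ds_idS : forall n (j : nat) (x : X n), (j <= n)%N ->
    d n (inord j.+1) (s n (inord j) x) = x;
  simp_ds_gt : forall n (i j : nat) (x : X n.+1), (j.+1 < i <= n.+2)%N ->
    d n.+1 (inord i) (s n.+1 (inord j) x) = s n (inord j) (d n (inord i.-1) x)
}.

Record simplicial_algebra (k : fieldType) := SimplicialAlgebra {
  salg_obj :> nat -> algebra_over k;
  aface : forall n, 'I_n.+2 -> {rmorphism salg_obj n.+1 -> salg_obj n};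
  adegen : forall n, 'I_n.+1 -> {rmorphism salg_obj n -> salg_obj n.+1};
  aface_scalar : forall n i c,
    @aface n i (alg_scalar (salg_obj n.+1) c) = alg_scalar (salg_obj n) c;
  adegen_scalar : forall n i c,
    @adegen n i (alg_scalar (salg_obj n) c) = alg_scalar (salg_obj n.+1) c;
  salg_identities : simplicial_identities aface adegen
}.

Record simplicial_vect (k : fieldType) := SimplicialVect {
  svect_obj :> nat -> lmodType k;
  face : forall n, 'I_n.+2 -> {linear svect_obj n.+1 -> svect_obj n};
  degen : forall n, 'I_n.+1 -> {linear svect_obj n -> svect_obj n.+1};
  svect_identities : simplicial_identities face degen
}.

(** A type carries at most one [lmodType] structure, and here it is the one
    over [k]; the module structure over the algebra is an explicit action that
    restricts along [alg_scalar] to the scalar multiplication.  *)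

Record left_action (k : fieldType) (A : algebra_over k) (V : lmodType k)
    (act : A -> V -> V) : Prop := LeftAction {
  lact1 : forall v, act 1 v = v;
  lactM : forall a b v, act (a * b) v = act a (act b v);
  lactDr : forall a u v, act a (u + v) = act a u + act a v;
  lactDl : forall v a b, act (a + b) v = act a v + act b v;
  lact_scalar : forall c v, act (alg_scalar A c) v = c *: v
}.

Record right_action (k : fieldType) (A : algebra_over k) (V : lmodType k)
    (act : V -> A -> V) : Prop := RightAction {
  ract1 : forall v, act v 1 = v;
  ractM : forall v a b, act v (a * b) = act (act v a) b;
  ractDl : forall a u v, act (u + v) a = act u a + act v a;
  ractDr : forall v a b, act v (a + b) = act v a + act v b;
  ract_scalar : forall v c, act v (alg_scalar A c) = c *: v
}.

Record simplicial_left_module (k : fieldType) (A : simplicial_algebra k) :=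
    SimplicialLeftModule {
  lmod_svect :> simplicial_vect k;
  lact : forall n, A n -> lmod_svect n -> lmod_svect n;
  lact_axiom : forall n, left_action (@lact n);
  lact_face : forall n i (a : A n.+1) b,
    face lmod_svect i (lact a b) = lact (aface A i a) (face lmod_svect i b);
  lact_degen : forall n i (a : A n) b,
    degen lmod_svect i (lact a b) = lact (adegen A i a) (degen lmod_svect i b)
}.

Record simplicial_right_module (k : fieldType) (A : simplicial_algebra k) :=
    SimplicialRightModule {
  rmod_svect :> simplicial_vect k;
  ract : forall n, rmod_svect n -> A n -> rmod_svect n;
  ract_axiom : forall n, right_action (@ract n);
  ract_face : forall n i m (a : A n.+1),
    face rmod_svect i (ract m a) = ract (face rmod_svect i m) (aface A i a);
  ract_degen : forall n i m (a : A n),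
    degen rmod_svect i (ract m a) = ract (degen rmod_svect i m) (adegen A i a)
}.

Arguments lact {k A} s n _ _.
Arguments ract {k A} s n _ _.

Section Presimplicial.
Variables (k : fieldType) (A : simplicial_algebra k).

Record presimplicial_morphism (B C : simplicial_left_module A) :=
    PresimplicialMorphism {
  psm_fun :> forall n, {linear B n -> C n};
  psm_lact : forall n (a : A n) b,
    psm_fun n (lact B n a b) = lact C n a (psm_fun n b);
  psm_face : forall n i b, psm_fun n (face B i b) = face C i (psm_fun n.+1 b)
}.

Definition psm_id (B : simplicial_left_module A) : presimplicial_morphism B B :=
  @PresimplicialMorphism B B (fun n => idfun)
    (fun _ _ _ => erefl) (fun _ _ _ => erefl).

Section Comp.
Variables (B C D : simplicial_left_module A).
Variables (g : presimplicial_morphism C D) (f : presimplicial_morphism B C).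

Let gf n : {linear B n -> D n} := g n \o f n.

Lemma psm_comp_lact n (a : A n) b : gf n (lact B n a b) = lact D n a (gf n b).
Proof. by rewrite /= !psm_lact. Qed.

Lemma psm_comp_face n i b : gf n (face B i b) = face D i (gf n.+1 b).
Proof. by rewrite /= !psm_face. Qed.

Definition psm_comp : presimplicial_morphism B D :=
  PresimplicialMorphism psm_comp_lact psm_comp_face.
End Comp.

Record presimplicial_homotopy (B C : simplicial_left_module A)
    (f g : presimplicial_morphism B C) := PresimplicialHomotopy {
  psh_fun :> forall n, 'I_n.+1 -> {linear B n -> C n.+1};
  psh_lact : forall n i (a : A n) b,
    @psh_fun n i (lact B n a b) = lact C n.+1 (adegen A i a) (@psh_fun n i b);
  psh_lt : forall n (i j : nat) (b : B n.+1), (i < j <= n.+1)%N ->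
    face C (inord i) (@psh_fun n.+1 (inord j) b)
      = @psh_fun n (inord j.-1) (face B (inord i) b);
  psh_eq : forall n (i : nat) (b : B n), (0 < i <= n)%N ->
    face C (inord i) (@psh_fun n (inord i) b)
      = face C (inord i) (@psh_fun n (inord i.-1) b);
  psh_gt : forall n (i j : nat) (b : B n.+1), (j.+1 < i <= n.+2)%N ->
    face C (inord i) (@psh_fun n.+1 (inord j) b)
      = @psh_fun n (inord j) (face B (inord i.-1) b);
  psh_first : forall n (b : B n), face C ord0 (@psh_fun n ord0 b) = f n b;
  psh_last : forall n (b : B n), face C ord_max (@psh_fun n ord_max b) = g n b
}.

Arguments psh_fun {B C f g} p n _.

Definition presimplicial_homotopy_equivalence (B C : simplicial_left_module A)
    (f : presimplicial_morphism B C) : Prop :=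
  exists g : presimplicial_morphism C B,
    inhabited (presimplicial_homotopy (psm_comp g f) (psm_id B)) /\
    inhabited (presimplicial_homotopy (psm_comp f g) (psm_id C)).

End Presimplicial.

Record subspace (k : fieldType) (V : lmodType k) := Subspace {
  subspace_mem :> V -> Prop;
  subspace0 : subspace_mem 0;
  subspaceP : forall c u v,
    subspace_mem u -> subspace_mem v -> subspace_mem (c *: u + v)
}.

Section QuotientSpace.
Variables (k : fieldType) (V : lmodType k) (S : subspace V).

Definition subspace_pred (x : V) : bool := `[< S x >].

Lemma subspace_zmod_closed : zmod_closed subspace_pred.
Proof.
split=> [|u v /asboolP Su /asboolP Sv]; apply/asboolP; first exact: subspace0.
by rewrite addrC -scaleN1r; apply: subspaceP.
Qed.

HB.instance Definition _ :=
  GRing.isZmodClosed.Build V subspace_pred subspace_zmod_closed.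

Definition quotient_space := Quotient.quot (GRing.ZmodClosed.clone V subspace_pred _).

HB.instance Definition _ := GRing.Zmodule.on quotient_space.

Definition quot_proj (x : V) : quotient_space := \pi_(Quotient.quot _) x.
Definition quot_repr (q : quotient_space) : V := repr (q : Quotient.quot _).

Lemma quot_reprK : cancel quot_repr quot_proj.
Proof. by move=> q; rewrite /quot_proj /quot_repr reprK. Qed.

Lemma quot_projD x y : quot_proj (x + y) = quot_proj x + quot_proj y.
Proof. exact: (raddfD (\pi_(Quotient.quot _))). Qed.

Lemma quot_projP x y : quot_proj x = quot_proj y <-> S (x - y).
Proof.
have E : (quot_proj x == quot_proj y) = (x - y \in subspace_pred).
  by rewrite [RHS]Quotient.idealrBE.
split=> [/eqP|Sxy]; first by rewrite E => /asboolP.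
by apply/eqP; rewrite E; apply/asboolP.
Qed.

Definition quot_scale (c : k) (q : quotient_space) : quotient_space :=
  quot_proj (c *: quot_repr q).

Lemma quot_scaleE c x : quot_scale c (quot_proj x) = quot_proj (c *: x).
Proof.
apply/quot_projP; rewrite -scalerBr -[c *: _]addr0.
apply: subspaceP (subspace0 S); apply/quot_projP; exact: quot_reprK.
Qed.

Lemma quot_scaleA a b q : quot_scale a (quot_scale b q) = quot_scale (a * b) q.
Proof. by rewrite -[q]quot_reprK !quot_scaleE scalerA. Qed.

Lemma quot_scale1 : left_id 1 quot_scale.
Proof. by move=> q; rewrite -[q]quot_reprK quot_scaleE scale1r. Qed.

Lemma quot_scaleDr : right_distributive quot_scale +%R.
Proof.
move=> a q r; rewrite -[q]quot_reprK -[r]quot_reprK -quot_projD !quot_scaleE.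
by rewrite scalerDr quot_projD.
Qed.

Lemma quot_scaleDl q : {morph quot_scale^~ q : a b / a + b}.
Proof.
by move=> a b; rewrite -[q]quot_reprK !quot_scaleE scalerDl quot_projD.
Qed.

HB.instance Definition _ := GRing.Zmodule_isLmodule.Build k quotient_space
  quot_scaleA quot_scale1 quot_scaleDr quot_scaleDl.

Lemma quot_proj_linear : linear quot_proj.
Proof. by move=> c x y; rewrite quot_projD -quot_scaleE. Qed.

HB.instance Definition _ :=
  GRing.isLinear.Build k V quotient_space _ quot_proj quot_proj_linear.

Section Lift.
Variables (W : lmodType k) (f : {linear V -> W}).
Hypothesis f_ker : forall x, S x -> f x = 0.

Definition quot_lift (q : quotient_space) : W := f (quot_repr q).

Lemma quot_liftE x : quot_lift (quot_proj x) = f x.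
Proof.
apply/eqP; rewrite -subr_eq0 -linearB; apply/eqP/f_ker/quot_projP.
exact: quot_reprK.
Qed.

Lemma quot_lift_linear : linear quot_lift.
Proof.
move=> c q r; rewrite -[q]quot_reprK -[r]quot_reprK -linearP.
by rewrite !quot_liftE linearP.
Qed.

End Lift.
End QuotientSpace.

(** The quotient of the vector space with basis [M * B] by the subspace
    spanned by the relations expressing that [(m, b) |-> m (x) b] is
    [k]-bilinear and [A]-balanced.  *)

Section Tensor.
Variables (k : fieldType) (A : pzRingType) (M B : lmodType k).
Variables (rho : M -> A -> M) (lam : A -> B -> B).

Local Notation F := {malg k[(M * B)%type]}.
Local Notation gen m b := (mkmalgU (m, b) 1 : F).

Inductive tensor_relation : F -> Prop :=
| tensor_rel0 : tensor_relation 0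
| tensor_relP c u v of tensor_relation u & tensor_relation v :
    tensor_relation (c *: u + v)
| tensor_rel_linl c m m' b :
    tensor_relation (gen (c *: m + m') b - (c *: gen m b + gen m' b))
| tensor_rel_linr c m b b' :
    tensor_relation (gen m (c *: b + b') - (c *: gen m b + gen m b'))
| tensor_rel_balanced m a b :
    tensor_relation (gen (rho m a) b - gen m (lam a b)).

Definition tensor_subspace : subspace F := Subspace tensor_rel0 tensor_relP.

Definition tensor := quotient_space tensor_subspace.

HB.instance Definition _ := GRing.Lmodule.on tensor.

Definition tens (m : M) (b : B) : tensor := quot_proj tensor_subspace (gen m b).

Lemma tensPl c m m' b : tens (c *: m + m') b = c *: tens m b + tens m' b.
Proof.
by rewrite /tens -linearP; apply/quot_projP; apply: tensor_rel_linl.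
Qed.

Lemma tensPr c m b b' : tens m (c *: b + b') = c *: tens m b + tens m b'.
Proof.
by rewrite /tens -linearP; apply/quot_projP; apply: tensor_rel_linr.
Qed.

Lemma tens_balanced m a b : tens (rho m a) b = tens m (lam a b).
Proof. by apply/quot_projP; apply: tensor_rel_balanced. Qed.

Lemma malg_gen (x : F) : x = \sum_(p <- msupp x) x@_p *: gen p.1 p.2.
Proof.
rewrite {1}[x]monalgE; apply: eq_bigr => -[m b] _; apply/malgP=> q.
by rewrite mcoeffZ !mcoeffU /= mulrnAr mulr1.
Qed.

Lemma tensor_span (t : tensor) :
  exists s : seq (k * (M * B)), t = \sum_(p <- s) p.1 *: tens p.2.1 p.2.2.
Proof.
rewrite -[t]quot_reprK; set x := quot_repr t.
exists [seq (x@_p, p) | p <- msupp x]; rewrite big_map /= {1}[x]malg_gen.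
by rewrite linear_sum; apply: eq_bigr => p _; rewrite linearZ.
Qed.

Lemma tensor_ind (P : tensor -> Prop) :
    (forall m b, P (tens m b)) ->
    (forall c t u, P t -> P u -> P (c *: t + u)) ->
  forall t, P t.
Proof.
move=> Pt Plin t; have [s ->] := tensor_span t.
elim: s => [|p s IHs]; last by rewrite big_cons; apply: Plin.
by rewrite big_nil -(addNr (tens 0 0)) -scaleN1r; apply: Plin.
Qed.

Section Lift.
Variables (W : lmodType k) (f : M -> B -> W).
Hypothesis f_linl : forall c m m' b, f (c *: m + m') b = c *: f m b + f m' b.
Hypothesis f_linr : forall c m b b', f m (c *: b + b') = c *: f m b + f m b'.
Hypothesis f_balanced : forall m a b, f (rho m a) b = f m (lam a b).

Definition malg_lift (x : F) : W := \sum_(p <- msupp x) x@_p *: f p.1 p.2.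

Lemma malg_liftw (x : F) (d : {fset M * B}) : (msupp x `<=` d)%fset ->
  malg_lift x = \sum_(p <- d) x@_p *: f p.1 p.2.
Proof.
move=> le_xd; rewrite /malg_lift; symmetry.
rewrite (big_fsetID _ (mem (msupp x))) /= [X in _ + X]big1_fset ?addr0.
  apply: eq_fbigl => p; rewrite !inE /=; apply: andb_idl.
  exact: (fsubsetP le_xd).
move=> p; rewrite !inE /= => /andP[_ px] _.
by rewrite mcoeff_outdom ?scale0r.
Qed.

Lemma malg_lift_linear : linear malg_lift.
Proof.
move=> c x y; pose d := (msupp x `|` msupp y `|` msupp (c *: x + y))%fset.
rewrite !(@malg_liftw _ d);
  try by apply/fsubsetP=> p px; rewrite !in_fsetU px ?orbT.
rewrite scaler_sumr -big_split; apply: eq_bigr => p _ /=.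
by rewrite mcoeffD mcoeffZ scalerDl scalerA.
Qed.

HB.instance Definition _ :=
  GRing.isLinear.Build k F W _ malg_lift malg_lift_linear.

Lemma malg_lift_gen m b : malg_lift (gen m b) = f m b.
Proof.
by rewrite /malg_lift msuppU oner_eq0 big_seq_fset1 mcoeffUU scale1r.
Qed.

Lemma malg_lift_rel x : tensor_subspace x -> malg_lift x = 0.
Proof.
elim=> {x} [|c u v _ u0 _ v0|c m m' b|c m b b'|m a b].
- exact: linear0.
- by rewrite linearP /= u0 v0 scaler0 addr0.
- by rewrite linearB linearP /= !malg_lift_gen f_linl subrr.
- by rewrite linearB linearP /= !malg_lift_gen f_linr subrr.
- by rewrite linearB /= !malg_lift_gen f_balanced subrr.
Qed.

Definition tensor_lift_fun : tensor -> W :=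
  quot_lift (S := tensor_subspace) malg_lift.

Lemma tensor_lift_linear : linear tensor_lift_fun.
Proof. exact: quot_lift_linear malg_lift_rel. Qed.

Definition tensor_lift : {linear tensor -> W} :=
  HB.pack_for {linear tensor -> W} tensor_lift_fun
    (GRing.isLinear.Build k tensor W _ tensor_lift_fun tensor_lift_linear).

Lemma tensor_liftE m b : tensor_lift (tens m b) = f m b.
Proof. by rewrite [LHS](quot_liftE malg_lift_rel) -malg_lift_gen. Qed.

End Lift.
End Tensor.

Section TensorMap.
Variables (k : fieldType) (A A' : pzRingType) (M B M' B' : lmodType k).
Variables (rho : M -> A -> M) (lam : A -> B -> B).
Variables (rho' : M' -> A' -> M') (lam' : A' -> B' -> B').
Variables (phi : A -> A') (f : {linear M -> M'}) (g : {linear B -> B'}).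
Hypothesis f_rho : forall m a, f (rho m a) = rho' (f m) (phi a).
Hypothesis g_lam : forall a b, g (lam a b) = lam' (phi a) (g b).

Let fg m b : tensor rho' lam' := tens rho' lam' (f m) (g b).

Lemma tensor_map_linl c m m' b : fg (c *: m + m') b = c *: fg m b + fg m' b.
Proof. by rewrite /fg linearP tensPl. Qed.

Lemma tensor_map_linr c m b b' : fg m (c *: b + b') = c *: fg m b + fg m b'.
Proof. by rewrite /fg linearP tensPr. Qed.

Lemma tensor_map_balanced m a b : fg (rho m a) b = fg m (lam a b).
Proof. by rewrite /fg f_rho g_lam tens_balanced. Qed.

Definition tensor_map : {linear tensor rho lam -> tensor rho' lam'} :=
  tensor_lift tensor_map_linl tensor_map_linr tensor_map_balanced.

Lemma tensor_mapE m b :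
  tensor_map (tens rho lam m b) = tens rho' lam' (f m) (g b).
Proof. exact: tensor_liftE. Qed.

End TensorMap.

Section SimplicialTensor.
Variables (k : fieldType) (A : simplicial_algebra k).
Variables (M : simplicial_right_module A) (B : simplicial_left_module A).

Definition stensor_obj (n : nat) : lmodType k := tensor (ract M n) (lact B n).

Definition stensor_face n (i : 'I_n.+2) :
    {linear stensor_obj n.+1 -> stensor_obj n} :=
  tensor_map (@ract_face _ _ M n i) (@lact_face _ _ B n i).

Definition stensor_degen n (i : 'I_n.+1) :
    {linear stensor_obj n -> stensor_obj n.+1} :=
  tensor_map (@ract_degen _ _ M n i) (@lact_degen _ _ B n i).

Lemma stensor_faceE n i m b :
  stensor_face i (tens (ract M n.+1) (lact B n.+1) m b)
    = tens (ract M n) (lact B n) (face M i m) (face B i b).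
Proof. exact: tensor_mapE. Qed.

Lemma stensor_degenE n i m b :
  stensor_degen i (tens (ract M n) (lact B n) m b)
    = tens (ract M n.+1) (lact B n.+1) (degen M i m) (degen B i b).
Proof. exact: tensor_mapE. Qed.

Lemma stensor_identities : simplicial_identities stensor_face stensor_degen.
Proof.
have [Mdd Mss Mlt Mid MidS Mgt] := svect_identities M.
have [Bdd Bss Blt Bid BidS Bgt] := svect_identities B.
split=> n.
- move=> i j x ij; elim/tensor_ind: x => [m b|c t u IHt IHu].
    by rewrite !stensor_faceE Mdd // Bdd.
  by rewrite !linearPZ IHt IHu.
- move=> i j x ij; elim/tensor_ind: x => [m b|c t u IHt IHu].
    by rewrite !stensor_degenE Mss // Bss.
  by rewrite !linearPZ IHt IHu.
- move=> i j x ij; elim/tensor_ind: x => [m b|c t u IHt IHu].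
    by rewrite stensor_degenE !stensor_faceE stensor_degenE Mlt // Blt.
  by rewrite !linearPZ IHt IHu.
- move=> j x jn; elim/tensor_ind: x => [m b|c t u IHt IHu].
    by rewrite stensor_degenE stensor_faceE Mid // Bid.
  by rewrite !linearPZ IHt IHu.
- move=> j x jn; elim/tensor_ind: x => [m b|c t u IHt IHu].
    by rewrite stensor_degenE stensor_faceE MidS // BidS.
  by rewrite !linearPZ IHt IHu.
- move=> i j x ij; elim/tensor_ind: x => [m b|c t u IHt IHu].
    by rewrite stensor_degenE !stensor_faceE stensor_degenE Mgt // Bgt.
  by rewrite !linearPZ IHt IHu.
Qed.

Definition stensor : simplicial_vect k := SimplicialVect stensor_identities.

End SimplicialTensor.

Section Homology.
Variables (k : fieldType) (X : simplicial_vect k).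

Definition boundary n (x : X n.+1) : X n :=
  \sum_(i < n.+2) (-1) ^+ i *: face X i x.

Lemma boundary_linear n : linear (@boundary n).
Proof.
move=> c x y; rewrite /boundary scaler_sumr -big_split; apply: eq_bigr => i _ /=.
by rewrite linearP scalerDr !scalerA mulrC.
Qed.

HB.instance Definition _ n :=
  GRing.isLinear.Build k (X n.+1) (X n) _ (@boundary n) (@boundary_linear n).

Definition is_cycle n : X n -> bool :=
  if n is m.+1 return X n -> bool then fun x => boundary x == 0
  else fun=> true.

Lemma is_cycle_closed n : subsemimod_closed (@is_cycle n).
Proof.
case: n => [|n]; split=> //.
  split=> [|x y /eqP x0 /eqP y0]; apply/eqP; first exact: linear0.
  by rewrite linearD /= x0 y0 addr0.
by move=> c x /eqP x0; apply/eqP; rewrite linearZ /= x0 scaler0.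
Qed.

HB.instance Definition _ n :=
  GRing.isSubmodClosed.Build k (X n) (@is_cycle n) (is_cycle_closed n).

Record cycle n := Cycle { cycle_val : X n; _ : cycle_val \in @is_cycle n }.

HB.instance Definition _ n := [isSub for @cycle_val n].
HB.instance Definition _ n := [Choice of cycle n by <:].
HB.instance Definition _ n := [SubChoice_isSubLmodule of cycle n by <:].

Definition is_boundary n (z : cycle n) : Prop :=
  exists y : X n.+1, boundary y = cycle_val z.

Lemma is_boundary0 n : is_boundary (0 : cycle n).
Proof. by exists 0; rewrite linear0. Qed.

Lemma is_boundaryP n c (u v : cycle n) :
  is_boundary u -> is_boundary v -> is_boundary (c *: u + v).
Proof. by move=> [x xu] [y yv]; exists (c *: x + y); rewrite linearP /= xu yv. Qed.

Definition boundary_subspace n : subspace (cycle n) :=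
  Subspace (@is_boundary0 n) (@is_boundaryP n).

Definition homology n : lmodType k := quotient_space (boundary_subspace n).

End Homology.

(* Main.v *)
Require Import Defs.
From HB Require Import structures.
From mathcomp Require Import all_boot all_algebra.

(** Tensoring with [M] turns the data of a presimplicial homotopy equivalence
    into a homotopy equivalence of chain complexes.

    A presimplicial morphism [f] is [A]-linear, so [m (x) b |-> m (x) f b] is
    well defined ([stensor_map]); it commutes with the face maps, hence with
    the boundary, and acts on homology ([homology_map]).

    If [h_j] is a presimplicial homotopy from [f] to [g], then
    [m (x) b |-> s_j m (x) h_j b] is well defined on the tensor product over
    [A], precisely because [h_j (a b) = s_j a h_j b] and
    [s_j (m a) = s_j m s_j a] ([stensor_homotopy]).  These maps satisfy the
    homotopy identities: for each pair of indices the face-degeneracy identity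
    in [M] has the same shape as the homotopy identity for [h], both sides of
    [d_i h_i = d_i h_(i-1)] and the two extreme faces being matched by
    [d_i s_i = id = d_(i+1) s_i] ([stensor_homotopic_cycle]).

    As in the classical simplicial case, the alternating sum
    [H = sum_j (-1)^j h_j] is then a chain homotopy: in [d H + H d] all terms
    cancel except [f] and [- g] ([alternating_homotopy_sum],
    [homotopy_cycle]).  Applied to the composites [g f] and [f g] this shows
    that the maps induced on homology are inverse to each other
    ([stensor_homology_map_cancel]).  *)

Import GRing.Theory.
Local Open Scope ring_scope.
Set Implicit Arguments.
Unset Strict Implicit.
Unset Printing Implicit Defensive.

(** * Cancellation in an alternating double sum *)

Section AlternatingSum.
Variables (R : pzRingType) (V : lmodType R).

(** With [a i j = d_i (h_j x)] and [c j i = h_j (d_i x)] this is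
    [d H + H d = f - g].  Column [j] of the first sum is cut at its two central
    entries [i = j] and [i = j.+1].  The entries above the cut in column [j.+1]
    and those below it in column [j] are, up to sign, the two parts of column
    [j] of the second sum; the central entries telescope.  For [n = 0] the
    second sum is empty, which covers degree 0, where the boundary is zero.  *)
Lemma alternating_homotopy_sum (n : nat) (a c : nat -> nat -> V) :
    (forall i j, (i < j <= n)%N -> a i j = c j.-1 i) ->
    (forall i, (0 < i <= n)%N -> a i i = a i i.-1) ->
    (forall i j, (j.+1 < i <= n.+1)%N -> a i j = c j i.-1) ->
  \sum_(0 <= j < n.+1) \sum_(0 <= i < n.+2) (-1) ^+ (i + j) *: a i j
    + \sum_(0 <= j < n) \sum_(0 <= i < n.+1) (-1) ^+ (i + j) *: c j i
  = a 0%N 0%N - a n.+1 n.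
Proof.
move=> a_lt a_eq a_gt.
pose L j := \sum_(0 <= i < j) (-1) ^+ (i + j) *: a i j.
pose U j := \sum_(j.+2 <= i < n.+2) (-1) ^+ (i + j) *: a i j.
have column j : (j < n.+1)%N ->
    \sum_(0 <= i < n.+2) (-1) ^+ (i + j) *: a i j
      = (a j j - a j.+1 j) + (L j + U j).
  move=> jn; rewrite (big_cat_nat (n := j)) //=; last exact: leqW (ltnW _).
  rewrite (big_ltn (m := j)); last exact: leqW.
  rewrite (big_ltn (m := j.+1)) ?ltnS // addSn exprS addnn -signr_odd odd_double.
  rewrite mulr1 scale1r scaleN1r -/(L j) -/(U j).
  by rewrite -[RHS]addrA [LHS]addrCA; congr (_ + _); rewrite [LHS]addrCA.
have cancel_c j : (j < n)%N ->
    L j.+1 + U j + \sum_(0 <= i < n.+1) (-1) ^+ (i + j) *: c j i = 0.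
  move=> jn; rewrite (big_cat_nat (n := j.+1)) //=; last exact: leqW.
  rewrite addrACA -[RHS](addr0 0); congr (_ + _).
    rewrite -big_split big_nat big1 //= => i ij.
    by rewrite a_lt ?jn ?andbT // addnS exprS mulN1r scaleNr addNr.
  rewrite /U [X in X + _]big_add1 /= -big_split big_nat big1 //= => i /andP[ji ni].
  by rewrite a_gt ?ltnS ?ji // addSn exprS mulN1r scaleNr addNr.
have telescope : \sum_(0 <= j < n.+1) (a j j - a j.+1 j) = a 0%N 0%N - a n.+1 n.
  rewrite sumrB big_nat_recl // [X in _ - X]big_nat_recr //=.
  rewrite [X in _ - X]addrC opprD addrACA -sumrB big_nat big1 ?addr0 // => j jn.
  by rewrite a_eq ?subrr.
rewrite big_nat (eq_bigr _ (fun j jn => column j (proj2 (andP jn)))) -big_nat.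
rewrite big_split /= telescope -addrA -[RHS]addr0; congr (_ + _).
rewrite big_split /= [X in X + _ + _]big_nat_recl // [X in _ + X + _]big_nat_recr //=.
rewrite [L 0%N]big_geq // [U n]big_geq // add0r addr0 -!big_split.
rewrite big_nat big1 //= => j jn; exact: cancel_c.
Qed.

End AlternatingSum.

(** * Maps induced on homology *)

Section HomologyMap.
Variables (k : fieldType) (X Y : simplicial_vect k).
Variable F : forall n, {linear X n -> Y n}.
Hypothesis F_face : forall n i x, F n (face X i x) = face Y i (F n.+1 x).

Lemma presimplicial_boundary n x : F n (boundary x) = boundary (F n.+1 x).
Proof.
by rewrite linear_sum; apply: eq_bigr => i _; rewrite linearZ /= F_face.
Qed.

Lemma presimplicial_cycle n (z : Defs.cycle X n) :
  F n (cycle_val z) \in @is_cycle k Y n.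
Proof.
case: n z => [|n] [x xc] //=; rewrite unfold_in /= -presimplicial_boundary.
by rewrite unfold_in /= in xc; rewrite (eqP xc) linear0.
Qed.

Definition cycle_map n (z : Defs.cycle X n) : Defs.cycle Y n :=
  Cycle (presimplicial_cycle z).

(** The composite of [cycle_map] with the projection to homology is the form
    that [quot_lift] takes, as it asks for a linear map out of cycles.  *)
Definition cycle_class_map n (z : Defs.cycle X n) : homology Y n :=
  quot_proj (boundary_subspace Y n) (cycle_map z).

Lemma cycle_class_map_linear n : linear (@cycle_class_map n).
Proof.
move=> c u v; rewrite /cycle_class_map -linearP; congr quot_proj.
by apply: val_inj; rewrite /= linearP.
Qed.

HB.instance Definition _ n :=
  GRing.isLinear.Build k (Defs.cycle X n) (homology Y n) _
    (@cycle_class_map n) (@cycle_class_map_linear n).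

Lemma cycle_class_map_boundary n (z : Defs.cycle X n) :
  boundary_subspace X n z -> cycle_class_map z = 0.
Proof.
case=> y yz; rewrite -(linear0 (quot_proj _)); apply/quot_projP.
by exists (F n.+1 y); rewrite subr0 -presimplicial_boundary yz.
Qed.

Definition homology_map n : {linear homology X n -> homology Y n} :=
  HB.pack_for {linear homology X n -> homology Y n}
    (quot_lift (S := boundary_subspace X n) (@cycle_class_map n))
    (GRing.isLinear.Build k _ _ _ _
      (quot_lift_linear (@cycle_class_map_boundary n))).

Lemma homology_mapE n z :
  homology_map n (quot_proj (boundary_subspace X n) z)
    = quot_proj (boundary_subspace Y n) (cycle_map z).
Proof. exact: (quot_liftE (@cycle_class_map_boundary n)). Qed.

End HomologyMap.

(** Every class is represented by a cycle, so a homotopy from [G F] to the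
    identity enters only through its values on cycles.  *)
Lemma homology_map_cancel (k : fieldType) (X Y : simplicial_vect k)
    (F : forall n, {linear X n -> Y n}) (G : forall n, {linear Y n -> X n})
    (F_face : forall n i x, F n (face X i x) = face Y i (F n.+1 x))
    (G_face : forall n i y, G n (face Y i y) = face X i (G n.+1 y)) n :
    (forall z : Defs.cycle X n,
      exists y, boundary y = G n (F n (cycle_val z)) - cycle_val z) ->
  cancel (homology_map F_face n) (homology_map G_face n).
Proof.
move=> GF q; rewrite -[q]quot_reprK; move: (quot_repr q) => {q} z.
by rewrite !homology_mapE; apply/quot_projP/GF.
Qed.

(** * Presimplicial homotopies of simplicial vector spaces *)

(** The sums over ordinals are rewritten over [nat] intervals, so that the
    index shifts in the homotopy identities need no ordinal arithmetic.  *)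
Lemma boundary_nat (k : fieldType) (X : simplicial_vect k) n (x : X n.+1) :
  boundary x = \sum_(0 <= i < n.+2) (-1) ^+ i *: face X (inord i) x.
Proof. by rewrite big_mkord; apply: eq_bigr => i _; rewrite inord_val. Qed.

Section Homotopy.
Variables (k : fieldType) (X Y : simplicial_vect k).
Variables f g : forall n, X n -> Y n.
Variable h : forall n, 'I_n.+1 -> {linear X n -> Y n.+1}.
Hypothesis h_lt : forall n (i j : nat) (x : X n.+1), (i < j <= n.+1)%N ->
  face Y (inord i) (@h n.+1 (inord j) x) = @h n (inord j.-1) (face X (inord i) x).
Hypothesis h_eq : forall n (i : nat) (x : X n), (0 < i <= n)%N ->
  face Y (inord i) (@h n (inord i) x) = face Y (inord i) (@h n (inord i.-1) x).
Hypothesis h_gt : forall n (i j : nat) (x : X n.+1), (j.+1 < i <= n.+2)%N ->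
  face Y (inord i) (@h n.+1 (inord j) x) = @h n (inord j) (face X (inord i.-1) x).
Hypothesis h_first : forall n (x : X n), face Y ord0 (@h n ord0 x) = f x.
Hypothesis h_last : forall n (x : X n), face Y ord_max (@h n ord_max x) = g x.

Definition homotopy_sum n (x : X n) : Y n.+1 :=
  \sum_(0 <= j < n.+1) (-1) ^+ j *: @h n (inord j) x.

Lemma boundary_homotopy_sum n (x : X n) : boundary (homotopy_sum x)
  = \sum_(0 <= j < n.+1) \sum_(0 <= i < n.+2)
      (-1) ^+ (i + j) *: face Y (inord i) (@h n (inord j) x).
Proof.
rewrite /homotopy_sum linear_sum; apply: eq_bigr => j _.
rewrite linearZ /= boundary_nat scaler_sumr; apply: eq_bigr => i _.
by rewrite scalerA -exprD addnC.
Qed.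

Lemma homotopy_sum_boundary n (x : X n.+1) : homotopy_sum (boundary x)
  = \sum_(0 <= j < n.+1) \sum_(0 <= i < n.+2)
      (-1) ^+ (i + j) *: @h n (inord j) (face X (inord i) x).
Proof.
apply: eq_bigr => j _; rewrite boundary_nat linear_sum scaler_sumr.
by apply: eq_bigr => i _; rewrite linearZ /= scalerA -exprD addnC.
Qed.

Lemma face_ends n (x : X n) :
  face Y (inord 0) (@h n (inord 0) x) - face Y (inord n.+1) (@h n (inord n) x)
    = f x - g x.
Proof.
rewrite -h_first -h_last; congr (face _ _ (h _ _) - face _ _ (h _ _));
  by apply: val_inj; rewrite /= inordK.
Qed.

(** On a cycle [z] the relation [d H + H d = f - g] reads [d (H z) = f z - g z],
    so [f] and [g] agree on homology.  *)
Lemma homotopy_cycle n (z : Defs.cycle X n) :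
  exists y, boundary y = f (cycle_val z) - g (cycle_val z).
Proof.
exists (homotopy_sum (cycle_val z)); case: n z => [|n] [x xc] /=.
  (* In degree 0 the boundary vanishes, so the [H d] sum is empty. *)
  rewrite boundary_homotopy_sum -face_ends.
  rewrite -(@alternating_homotopy_sum _ _ 0
    (fun i j => face Y (inord i) (@h 0 (inord j) x)) (fun _ _ => 0)).
  - by rewrite [X in _ + X]big_geq ?addr0.
  - by move=> i [|j] /andP[].
  - by move=> [|i] /andP[].
  - by move=> [|[|i]] j /andP[].
have /eqP x0 : boundary x == 0 by [].
rewrite -face_ends -(@alternating_homotopy_sum _ _ n.+1
  (fun i j => face Y (inord i) (@h n.+1 (inord j) x))
  (fun j i => @h n (inord j) (face X (inord i) x))).
- rewrite boundary_homotopy_sum -homotopy_sum_boundary x0.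
  by rewrite [X in _ + X]big1 ?addr0 // => j _; rewrite linear0 scaler0.
- by move=> i j ij; apply: h_lt.
- by move=> i ?; apply: h_eq.
- by move=> i j ij; apply: h_gt.
Qed.

End Homotopy.

(** * The tensor product with a simplicial right module *)

Section TensorFunctor.
Variables (k : fieldType) (A : simplicial_algebra k).
Variable M : simplicial_right_module A.

(** [stensor_faceE] with its left-hand side keyed on [face], the form in which
    the face maps of [stensor M B] appear in statements about an arbitrary
    simplicial vector space.  *)
Lemma face_tens B n i m b :
  face (stensor M B) i (tens (ract M n.+1) (lact B n.+1) m b)
    = tens (ract M n) (lact B n) (face M i m) (face B i b).
Proof. exact: stensor_faceE. Qed.

Lemma stensor_linear_ext B n (W : lmodType k)
    (u v : {linear stensor M B n -> W}) :
    (forall m b, u (tens (ract M n) (lact B n) m b)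
                 = v (tens (ract M n) (lact B n) m b)) ->
  u =1 v.
Proof.
move=> uv; apply: tensor_ind => [//|c t t' ut ut'].
by rewrite (linearP u) (linearP v) ut ut'.
Qed.

(** The form of [stensor_linear_ext] that unifies with the two sides of the
    simplicial identities, each an application of one operator to another.  *)
Lemma stensor_comp_ext B n (V V' W : lmodType k)
    (u : {linear stensor M B n -> V}) (v : {linear V -> W})
    (u' : {linear stensor M B n -> V'}) (v' : {linear V' -> W}) :
    (forall m b, v (u (tens (ract M n) (lact B n) m b))
                 = v' (u' (tens (ract M n) (lact B n) m b))) ->
  forall t, v (u t) = v' (u' t).
Proof. exact: (@stensor_linear_ext B n W (v \o u) (v' \o u')). Qed.

Section Map.
Variables (B C : simplicial_left_module A) (f : presimplicial_morphism B C).

Definition stensor_map n : {linear stensor M B n -> stensor M C n} :=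
  @tensor_map k (A n) (A n) (M n) (B n) (M n) (C n) (ract M n) (lact B n)
    (ract M n) (lact C n) idfun idfun (f n)
    (fun _ _ => erefl) (@psm_lact _ _ _ _ f n).

Lemma stensor_mapE n m b :
  stensor_map n (tens (ract M n) (lact B n) m b)
    = tens (ract M n) (lact C n) m (f n b).
Proof. exact: tensor_mapE. Qed.

Lemma stensor_map_face n i t :
  stensor_map n (face (stensor M B) i t)
    = face (stensor M C) i (stensor_map n.+1 t).
Proof.
move: t; apply: stensor_comp_ext => m b.
by rewrite face_tens !stensor_mapE face_tens psm_face.
Qed.

End Map.

Section HomotopyTensor.
Variables (B C : simplicial_left_module A) (f g : presimplicial_morphism B C).
Variable p : presimplicial_homotopy f g.

Definition stensor_homotopy n (j : 'I_n.+1) :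
    {linear stensor M B n -> stensor M C n.+1} :=
  tensor_map (@ract_degen _ _ M n j) (@psh_lact _ _ _ _ _ _ p n j).

Lemma stensor_homotopyE n j m b :
  stensor_homotopy j (tens (ract M n) (lact B n) m b)
    = tens (ract M n.+1) (lact C n.+1) (degen M j m) (psh_fun p j b).
Proof. exact: tensor_mapE. Qed.

(** The operators [s_j (x) h_j] satisfy the homotopy identities, which are
    checked on pure tensors factor by factor.  *)
Lemma stensor_homotopic_cycle n (z : Defs.cycle (stensor M B) n) :
  exists y, boundary y
    = stensor_map f n (cycle_val z) - stensor_map g n (cycle_val z).
Proof.
have [_ _ Mlt Mid MidS Mgt] := svect_identities M.
apply: (homotopy_cycle (f := stensor_map f) (g := stensor_map g)
  (h := stensor_homotopy)) => {z}n.
- move=> i j t ij; move: t; apply: stensor_comp_ext => m b.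
  rewrite face_tens !stensor_homotopyE face_tens.
  by rewrite Mlt // psh_lt.
- move=> [//|i] t i_n; move: t; apply: stensor_comp_ext => m b.
  rewrite !stensor_homotopyE !face_tens.
  (* Both [d_(i+1) s_(i+1) m] and [d_(i+1) s_i m] are equal to [m]. *)
  by rewrite Mid // MidS 1?ltnW // psh_eq.
- move=> i j t ij; move: t; apply: stensor_comp_ext => m b.
  rewrite face_tens !stensor_homotopyE face_tens.
  by rewrite Mgt // psh_gt.
- apply: (stensor_comp_ext (u' := stensor_map f n) (v' := idfun)) => m b.
  rewrite stensor_homotopyE face_tens stensor_mapE psh_first; congr tens.
  rewrite -[RHS](Mid n 0%N m) //; congr (face _ _ (degen _ _ _));
    by apply: val_inj; rewrite /= inordK.
- apply: (stensor_comp_ext (u' := stensor_map g n) (v' := idfun)) => m b.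
  rewrite stensor_homotopyE face_tens stensor_mapE psh_last; congr tens.
  rewrite -[RHS](MidS n n m) //; congr (face _ _ (degen _ _ _));
    by apply: val_inj; rewrite /= inordK.
Qed.

End HomotopyTensor.

Lemma stensor_map_id B n : stensor_map (psm_id B) n =1 id.
Proof.
apply: (stensor_linear_ext (v := idfun)) => m b; exact: stensor_mapE.
Qed.

Lemma stensor_map_comp B C D (g : presimplicial_morphism C D)
    (f : presimplicial_morphism B C) n :
  stensor_map (psm_comp g f) n =1 stensor_map g n \o stensor_map f n.
Proof.
apply: (stensor_comp_ext (u := stensor_map (psm_comp g f) n) (v := idfun)) => m b.
by rewrite !stensor_mapE.
Qed.

(** * Homotopy invariance *)

Definition stensor_homology_map B C (f : presimplicial_morphism B C) n :
    {linear homology (stensor M B) n -> homology (stensor M C) n} :=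
  homology_map (stensor_map_face f) n.

Lemma stensor_homology_map_cancel B C (f : presimplicial_morphism B C)
    (g : presimplicial_morphism C B) n :
    presimplicial_homotopy (psm_comp g f) (psm_id B) ->
  cancel (stensor_homology_map f n) (stensor_homology_map g n).
Proof.
move=> p; apply: homology_map_cancel => z.
have [y yz] := stensor_homotopic_cycle p z.
by exists y; rewrite yz stensor_map_comp stensor_map_id.
Qed.

End TensorFunctor.

Theorem proposition3p6 (k : fieldType) (A : simplicial_algebra k)
    (B C : simplicial_left_module A) (M : simplicial_right_module A) :
  (exists f : presimplicial_morphism B C,
     presimplicial_homotopy_equivalence f) ->
  forall n : nat,
    exists phi : {linear homology (stensor M B) n -> homology (stensor M C) n},
      bijective phi.
Proof.
case=> f [g [[gf] [fg]]] n; exists (stensor_homology_map M f n).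
exists (stensor_homology_map M g n); exact: stensor_homology_map_cancel.
Qed.
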